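(* Let $X$ be a Lindelöf Hausdorff almost radial space. Then $\sigma_C(X) = F(X)$.
   Context: A space is Lindelöf if every open cover has a countable subcover (no regularity is assumed). A transfinite sequence $\{x_\alpha : \alpha < \kappa\}$ ($\kappa$ an infinite cardinal, called its length) converges to a point $x$ if every open neighbourhood of $x$ contains $\{x_\alpha : \beta \leq \alpha < \kappa\}$ for some $\beta < \kappa$. A topological space $X$ is almost radial if for every non-closed set $A \subset X$ there are a point $x \in \overline{A} \setminus A$ and a transfinite sequence $\{x_\alpha : \alpha < \kappa\} \subset A$ converging to $x$ such that $x \notin \overline{\{x_\alpha : \alpha < \beta\}}$ for every $\beta < \kappa$. The radial character $\sigma_C(X)$ is the minimum infinite cardinal $\kappa$ such that every non-closed set $A \subset X$ contains a transfinite sequence of length at most $\kappa$ converging to a point outside $A$. A sequence $\{x_\alpha : \alpha < \kappa\}$ in $X$ is free if $\overline{\{x_\alpha : \alpha < \beta\}} \cap \overline{\{x_\alpha : \beta \leq \alpha < \kappa\}} = \emptyset$ for every $\beta < \kappa$. $F(X)$ is the supremum of the cardinalities of free sequences in $X$. As is standard, all cardinal functions are taken to be infinite (so $F(X)$ means $\max\{\omega, F(X)\}$). *)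

(* Defs.v *)
From mathcomp Require Import all_boot.
From mathcomp Require Import boolp classical_sets cardinality wochoice topology.

Set Implicit Arguments.
Unset Strict Implicit.
Unset Printing Implicit Defensive.

Local Open Scope classical_set_scope.
Local Open Scope card_scope.

(** A cardinal is rendered, up to order isomorphism, as an initial ordinal:
    a well-ordered type (whose elements are the ordinals [a < kappa]) all of
    whose proper initial segments have strictly smaller cardinality than the
    whole. Finite cardinals, including 0, are allowed. *)
Record cardinal := Cardinal {
  ords :> Type;
  ord_le : rel ords;
  ord_le_wo : well_order ord_le;
  ord_le_initial : forall b : ords,
    ~ ([set: ords] #<= [set a | ord_le a b /\ a <> b]) }.

Definition ord_lt (kappa : cardinal) (a b : kappa) := ord_le a b /\ a <> b.

Definition cardinal_le (kappa mu : cardinal) : Prop :=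
  [set: kappa] #<= [set: mu].

Definition infinite_cardinal (kappa : cardinal) : Prop :=
  infinite_set [set: kappa].

Section Sequences.
Variables (X : topologicalType) (kappa : cardinal).
Implicit Types (s : kappa -> X) (b : kappa).

Definition head_set s b : set X := s @` [set a | ord_lt a b].

Definition tail_set s b : set X := s @` [set a | ord_le b a].

Definition seq_converges s (x : X) :=
  forall U : set X, open U -> U x -> exists b, tail_set s b `<=` U.

Definition free_sequence s :=
  forall b, closure (head_set s b) `&` closure (tail_set s b) = set0.

End Sequences.

Definition lindelof_space (X : topologicalType) :=
  forall C : set (set X),
    (forall U, C U -> open U) -> \bigcup_(U in C) U = [set: X] ->
  exists D : set (set X),
    [/\ D `<=` C, countable D & \bigcup_(U in D) U = [set: X]].

Definition almost_radial (X : topologicalType) :=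
  forall A : set X, ~ closed A ->
  exists x : X, (closure A `\` A) x /\
  exists (kappa : cardinal) (s : kappa -> X),
    [/\ infinite_cardinal kappa,
        range s `<=` A,
        seq_converges s x
      & forall b : kappa, ~ closure (head_set s b) x].

Definition sequences_upto_detect_closed (X : topologicalType)
    (kappa : cardinal) :=
  forall A : set X, ~ closed A ->
  exists (lambda : cardinal) (s : lambda -> X) (x : X),
    [/\ infinite_cardinal lambda,
        cardinal_le lambda kappa,
        range s `<=` A,
        ~ A x
      & seq_converges s x].

(** [radial_character X kappa] means sigma_C(X) = kappa. *)
Definition radial_character (X : topologicalType) (kappa : cardinal) :=
  [/\ infinite_cardinal kappa,
      sequences_upto_detect_closed X kappa
    & forall mu : cardinal, infinite_cardinal mu ->
        sequences_upto_detect_closed X mu -> cardinal_le kappa mu].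

Definition bounds_free_sequences (X : topologicalType) (kappa : cardinal) :=
  forall (lambda : cardinal) (s : lambda -> X),
    free_sequence s -> range s #<= [set: kappa].

(** [free_sequence_number X kappa] means F(X) = kappa, where F(X) is the
    larger of omega and the supremum of the cardinalities of the free
    sequences, i.e. the least infinite cardinal bounding all of them. *)
Definition free_sequence_number (X : topologicalType) (kappa : cardinal) :=
  [/\ infinite_cardinal kappa,
      bounds_free_sequences X kappa
    & forall mu : cardinal, infinite_cardinal mu ->
        bounds_free_sequences X mu -> cardinal_le kappa mu].

(** Both invariants are determined up to equipotence by the two relations
    above, so a common value [kappa] expresses equality of the invariants. *)
Lemma radial_character_unique (X : topologicalType) (kappa mu : cardinal) :
  radial_character X kappa -> radial_character X mu ->
  [set: kappa] #= [set: mu].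
Proof.
move=> [ik ck lk] [im cm lm]; rewrite card_eq_le.
by apply/andP; split; [exact: lk|exact: lm].
Qed.

Lemma free_sequence_number_unique (X : topologicalType)
    (kappa mu : cardinal) :
  free_sequence_number X kappa -> free_sequence_number X mu ->
  [set: kappa] #= [set: mu].
Proof.
move=> [ik ck lk] [im cm lm]; rewrite card_eq_le.
by apply/andP; split; [exact: lk|exact: lm].
Qed.

(* Main.v *)
Require Import Defs.
From mathcomp Require Import all_boot.
From mathcomp Require Import boolp classical_sets cardinality wochoice topology.
From mathcomp Require Import functions.

Set Implicit Arguments.
Unset Strict Implicit.
Unset Printing Implicit Defensive.

Local Open Scope classical_set_scope.
Local Open Scope card_scope.

(** Both invariants turn out to be the least infinite cardinal satisfying one
    condition, because for an infinite [kappa] the two conditions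
    [bounds_free_sequences X kappa] and [sequences_upto_detect_closed X kappa]
    are equivalent; the least infinite cardinal satisfying the first is then
    F(X) and sigma_C(X) at once.

    From a bound on free sequences to short convergent sequences
    ([detect_of_bounds_free]): almost radiality gives a sequence s of length
    lambda in the non-closed set A, converging to a point x outside A that is in
    the closure of no head of s.  Let mu be the cofinality of lambda; a cofinal
    subsequence of length mu still converges to x, so the point is to bound mu.
    If mu is countable there is nothing to do.  Otherwise the closure H of a
    head of s is Lindelof and misses x, each of its points is separated from x,
    hence from some tail of s, by an open set, and countably many of these open
    sets cover H; since countable subsets of lambda are bounded, a single tail
    has closure disjoint from H ([separate_head_tail]).  A recursion of length
    mu therefore extracts a cofinal subsequence of s that is free, so that
    mu <= kappa.

    From short convergent sequences to a bound on free sequences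
    ([bounds_free_of_detect]): suppose s is free of length greater than kappa,
    and truncate it to length kappa^+.  As kappa^+ has uncountable cofinality,
    the closures of the tails have the countable intersection property and share
    a point p.  The union G of the closures of the heads is closed: a sequence
    of length at most kappa in G lies in the closure of a single head, because
    kappa^+ is regular, and so does its limit.  Hence p is in G, which puts p in
    the closure of a head and in that of the matching tail.

    The set theory behind this is the regularity of kappa^+, which comes from
    kappa * kappa = kappa ([card_square]), and the existence of cofinalities.
    Its engine is one recursive construction, [card_le_or_segment]: a
    well-ordered set either injects into S or has an initial segment into which
    S injects. *)

(** * Injections *)

Lemma card_le_injP (T U : Type) (A : set T) (B : set U) : A !=set0 ->
  A #<= B <-> exists f : T -> U, set_fun A B f /\ set_inj A f.
Proof.
move=> [a Aa]; split=> [/card_leP[f]|[f [fAB finj]]].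
  pose g x := if pselect (A x) is left Ax then val (f (SigSub (mem_set Ax)))
              else val (f (SigSub (mem_set Aa))).
  exists g; split=> [x Ax|x y /set_mem Ax /set_mem Ay].
    by rewrite /g; case: pselect => // ?; apply: set_valP.
  rewrite /g; case: pselect => // Ax'; case: pselect => // Ay' /val_inj.
  by move/(inj (mem_set Logic.I) (mem_set Logic.I)) => [].
rewrite -(card_le_eql (inj_card_eq finj)); apply: subset_card_le.
by move=> _ [x Ax <-]; exact: fAB.
Qed.

Lemma card_leX (T T' U U' : Type) (A : set T) (B : set U) (A' : set T')
    (B' : set U') : A #<= A' -> B #<= B' -> A `*` B #<= A' `*` B'.
Proof.
have [->|/set0P[[a b] [/= Aa Bb]]] := eqVneq (A `*` B) set0.
  by move=> *; exact: card_ge0.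
move=> /card_le_injP-/(_ (ex_intro _ _ Aa))[f [fA finj]].
move=> /card_le_injP-/(_ (ex_intro _ _ Bb))[g [gB ginj]].
apply/card_le_injP; first by exists (a, b).
exists (fun p => (f p.1, g p.2)); split=> [p [? ?]|[x y] [x' y']].
  by split; [exact: fA|exact: gB].
rewrite !inE => -[/= Ax By] [/= Ax' By'] [ef eg].
by congr pair; [apply: finj|apply: ginj]; rewrite ?inE.
Qed.

(** The new point goes to the first term of a sequence of distinct points of
    [A], which is shifted by one to make room. *)
Lemma infinite_cardU1 (T : Type) (A : set T) (a : T) :
  infinite_set A -> A `|` [set a] #<= A.
Proof.
move=> /infiniteP/card_le_injP-/(_ (ex_intro _ 0%N Logic.I))[f [fA finj]].
have {}finj m n : f m = f n -> m = n by apply: finj; rewrite inE.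
have [Aa|nAa] := pselect (A a).
  by apply: subset_card_le => x [//|->].
have [g gP] : exists g : T -> nat, forall n, g (f n) = n.
  have /choice[g gP] x : exists n, forall m, f m = x -> m = n.
    have [[m <-]|nx] := pselect (exists m, f m = x).
      by exists m => k /finj.
    by exists 0%N => m fm; case: nx; exists m.
  by exists g => n; rewrite -(gP (f n) n).
pose h x := if pselect (x = a) then f 0%N else
            if pselect (range f x) then f (g x).+1 else x.
apply/card_le_injP; first by exists a; right.
exists h; split=> [x|x y].
  rewrite /h; case: pselect => /= [_ _|xa [|//]]; first exact: fA.
  by case: pselect => /= [_ _|_]; first exact: fA.
move=> _ _; rewrite /h.
have S z : range f z -> f (g z) = z by move=> [n _ <-]; rewrite gP.
case: (pselect (x = a)) => xa; case: (pselect (y = a)) => ya /=.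
- by rewrite xa ya.
- case: (pselect (range f y)) => fy /= e; first by move/finj: e.
  by case: fy; exists 0%N.
- case: (pselect (range f x)) => fx /= e; first by move/finj: e.
  by case: fx; exists 0%N.
- case: (pselect (range f x)) => fx; case: (pselect (range f y)) => fy //= e.
  + by rewrite -(S x)// -(S y)//; move/finj: e => [->].
  + by case: fy; rewrite -e; exists (g x).+1.
  + by case: fx; rewrite e; exists (g y).+1.
Qed.

(** * Choice along a well-founded relation *)

(** Recursive choice in which the constraint on the value at [i] depends on the
    earlier values only through the set that they form. *)
Lemma wf_choice (T U : Type) (lt : T -> T -> Prop) (Q : T -> set U -> U -> Prop) :
  well_founded lt -> U ->
  (forall i (g : T -> U), exists u, Q i (g @` [set j | lt j i]) u) ->
  exists g : T -> U, forall i, Q i (g @` [set j | lt j i]) (g i).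
Proof.
move=> ltwf u0 stepP; pose step i g := cid (stepP i g).
pose ext i (r : forall j, lt j i -> U) j :=
  if pselect (lt j i) is left ji then r j ji else u0.
pose F i (r : forall j, lt j i -> U) := projT1 (step i (ext i r)).
exists (Fix ltwf _ F) => i.
(* The choice made by F at i sees only the restriction of the recursive calls
   below i, so F is extensional and the fixpoint equation applies. *)
rewrite Fix_eq; last first.
  by move=> j r r' rr'; congr F; apply: functional_extensionality_dep => k;
     apply: functional_extensionality_dep.
rewrite /F; set r := (X in projT1 (step i X)).
have -> : [set Fix ltwf _ F j | j in [set j | lt j i]] = [set r j | j in [set j | lt j i]].
  by apply: eq_imagel => j /= ji; rewrite /r /ext; case: pselect.
exact: projT2 (step i r).
Qed.

(** Send each [x] in turn to a point of [S] not yet used.  The recursion can only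
    get stuck at a [t] whose predecessors have images that exhaust [S], and then
    [S] injects into the segment below [t]. *)
Lemma card_le_or_segment (T U : Type) (lt : T -> T -> Prop) (D : set T)
    (S : set U) :
  well_founded lt -> (forall x y, D x -> D y -> x <> y -> lt x y \/ lt y x) ->
  D #<= S \/ exists2 t, D t & S #<= D `&` [set x | lt x t].
Proof.
move=> ltwf tot.
have [[t Dt St]|noseg] := pselect (exists2 t, D t & S #<= D `&` [set x | lt x t]).
  by right; exists t.
left.
have [->|/set0P[t0 Dt0]] := eqVneq D set0; first exact: card_ge0.
have [S0|/set0P[u0 Su0]] := eqVneq S set0.
  by case: noseg; exists t0 => //; rewrite S0 card_ge0.
pose lt' x y := D x /\ D y /\ lt x y.
have lt'wf : well_founded lt'.
  move=> x; elim: (ltwf x) => {}x _ IH; constructor => y [_ [_ yx]].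
  exact: IH.
have [|g gP] := @wf_choice _ U lt' (fun i B u => D i -> S u /\ ~ B u) lt'wf u0.
  move=> i g; have [Di|nDi] := pselect (D i); last by exists u0.
  apply: contrapT => /forallNP H; apply: noseg; exists i => //.
  apply: (@card_le_trans _ _ _ (g @` [set j | lt' j i])); last first.
    apply: card_le_trans (card_image_le _ _) _; apply: subset_card_le.
    by move=> j [? []].
  by apply: subset_card_le => u Su; apply: contrapT => ngu; case: (H u).
apply/card_le_injP; first by exists t0.
exists g; split=> [i /gP[]//|i j]; rewrite !inE => Di Dj e.
apply: contrapT => /tot-/(_ Di Dj)[ij|ji].
  by have [_] := gP _ Dj; apply; exists i.
by have [_] := gP _ Di; apply; exists j.
Qed.

(** * Well-orders and cardinals *)

Section WellOrder.
Variables (T : Type) (R : rel T).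
Hypothesis Rwo : well_order R.

Lemma well_order_min (A : set T) : A !=set0 ->
  exists2 m, A m & forall x, A x -> R m x.
Proof.
move=> [a Aa]; have [|m [[Am lb] _]] := Rwo (A := [pred x | `[< A x >]]).
  by exists a; apply/asboolP.
by exists m; [exact/asboolP|move=> x Ax; apply: lb; exact/asboolP].
Qed.

Lemma well_order_refl x : R x x.
Proof. by have [|_ -> xx] := @well_order_min [set x]; [exists x|exact: xx]. Qed.

Lemma well_order_total x y : R x y \/ R y x.
Proof.
have [|m [] -> h] := @well_order_min [set x; y]; first by exists x; left.
  by left; apply: h; right.
by right; apply: h; left.
Qed.

Lemma well_order_anti x y : R x y -> R y x -> x = y.
Proof.
move=> xy yx.
have [|z [_ uz]] := Rwo (A := [pred z | `[< z = x \/ z = y >]]).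
  by exists x; apply/asboolP; left.
rewrite -(uz x); first rewrite -(uz y)//.
  split; first by apply/asboolP; right.
  by move=> t /asboolP[]->//; exact: well_order_refl.
split; first by apply/asboolP; left.
by move=> t /asboolP[]->//; exact: well_order_refl.
Qed.

Lemma well_order_trans x y z : R x y -> R y z -> R x z.
Proof.
move=> xy yz.
have [|m mA h] := @well_order_min [set t | [\/ t = x, t = y | t = z]].
  by exists x; constructor.
case: mA h => -> h.
- by apply: h; constructor.
- by rewrite (well_order_anti xy) //; apply: h; constructor.
- by rewrite -(well_order_anti yz) //; apply: h; constructor.
Qed.

Lemma well_order_wf : well_founded (fun a b => R a b /\ a <> b).
Proof.
move=> x; apply: contrapT => nx.
have [|m nm h] := @well_order_min [set x | ~ Acc (fun a b => R a b /\ a <> b) x].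
  by exists x.
apply: nm; constructor => y [ym yneq]; apply: contrapT => /h my.
by apply: yneq; exact: (well_order_anti ym my).
Qed.

End WellOrder.

Section Cardinals.
Variable kappa : cardinal.
Implicit Types a b c : kappa.

Lemma ord_lt_wf : well_founded (@ord_lt kappa).
Proof. exact: well_order_wf (@ord_le_wo kappa). Qed.

Lemma ord_le_total a b : ord_le a b \/ ord_le b a.
Proof. exact: well_order_total (@ord_le_wo kappa) _ _. Qed.

Lemma ord_lexx a : ord_le a a. Proof. exact: well_order_refl (@ord_le_wo kappa) _. Qed.

Lemma ord_le_trans a b c : ord_le a b -> ord_le b c -> ord_le a c.
Proof. by move=> ab bc; exact: (well_order_trans (@ord_le_wo kappa) ab bc). Qed.

Lemma ord_le_anti a b : ord_le a b -> ord_le b a -> a = b.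
Proof. by move=> ab ba; exact: (well_order_anti (@ord_le_wo kappa) ab ba). Qed.

Lemma ord_lt_total a b : a <> b -> ord_lt a b \/ ord_lt b a.
Proof.
by move=> ab; have [?|?] := ord_le_total a b; [left|right; split=> // /esym].
Qed.

Lemma ord_leNgt a b : ord_le a b <-> ~ ord_lt b a.
Proof.
split=> [ab [ba ne]|nba]; first exact: ne (ord_le_anti ba ab).
by have [//|ba] := ord_le_total a b; have [<-|//] := pselect (b = a);
   [exact: ord_lexx|move=> ne; case: nba].
Qed.

Lemma ord_ltW a b : ord_lt a b -> ord_le a b. Proof. by case. Qed.

Lemma ord_lt_le_trans a b c : ord_lt a b -> ord_le b c -> ord_lt a c.
Proof.
move=> [ab ne] bc; split; first exact: ord_le_trans bc.
by move=> ac; apply: ne; apply: ord_le_anti => //; rewrite ac.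
Qed.

Lemma ord_min (A : set kappa) : A !=set0 ->
  exists2 m, A m & forall x, A x -> ord_le m x.
Proof. exact: well_order_min (@ord_le_wo kappa) _. Qed.

End Cardinals.

(** The order induced on [D] makes it an initial ordinal as soon as no proper
    initial segment of [D] is as large as [D]. *)
Lemma cardinal_of_initial (T : Type) (R : rel T) (D : set T) : well_order R ->
  (forall b, D b -> ~ (D #<= D `&` [set a | R a b /\ a <> b])) ->
  exists kappa : cardinal, [set: kappa] #= D.
Proof.
move=> Rwo Dini.
pose le (x y : D) := R (val x) (val y).
have lewo : well_order le.
  apply: antisymmetric_well_order => [x y /andP[xy yx]|A [x Ax]].
    exact/val_inj/(well_order_anti Rwo).
  have [|m [z Az <-] h] := @well_order_min _ _ Rwo (val @` [set` A]).
    by exists (val x), x.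
  by exists z; split=> // y Ay; apply: h; exists y.
have leini b : ~ ([set: D] #<= [set a | le a b /\ a <> b]).
  rewrite (card_le_eql (card_setT D)) => Db; apply: (Dini (val b)).
    exact: set_valP.
  apply: card_le_trans Db _.
  rewrite -(card_le_eql (@inj_card_eq _ _ _ val _)); last first.
    by move=> x y _ _ /val_inj.
  apply: subset_card_le => _ [x [xb ne] <-]; split; first exact: set_valP.
  by split=> // /val_inj.
by exists (Cardinal lewo leini); exact: card_setT.
Qed.

(** Well-order [A] and cut at the first point below which there already are as
    many points as in [A], if there is one. *)
Lemma cardinal_of_set (T : Type) (A : set T) :
  exists kappa : cardinal, [set: kappa] #= A.
Proof.
have [R Rwo] := well_ordering_principle {classic A}.
pose S := [set b : {classic A} | A #<= [set a | R a b /\ a <> b]].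
have [S0|/set0P/(well_order_min Rwo)[b Ab bmin]] := eqVneq S set0.
  have [|kappa kA] := cardinal_of_initial (D := [set: {classic A}]) Rwo.
    move=> b _; rewrite setTI (card_le_eql (card_setT A)) => Ab.
    by suff: S b by rewrite S0.
  by exists kappa; rewrite (card_eql kA) card_setT.
have [c [cb ne] Dc|kappa kA] := cardinal_of_initial
    (D := [set a | R a b /\ a <> b]) Rwo.
  apply: ne; apply: well_order_anti cb _ => //; apply: bmin.
  apply: card_le_trans Ab (card_le_trans Dc _).
  by apply: subset_card_le => ? [].
exists kappa; rewrite (card_eql kA) card_eq_le; apply/andP; split=> //.
by rewrite -(card_le_eqr (card_setT A)) card_leT.
Qed.

Lemma cardinal_le_or_segment (U : Type) (kappa : cardinal) (S : set U) :
  [set: kappa] #<= S \/ exists b : kappa, S #<= [set a | ord_lt a b].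
Proof.
have [||] := @card_le_or_segment _ _ _ [set: kappa] S (@ord_lt_wf kappa).
- by move=> x y _ _; exact: ord_lt_total.
- by left.
- by case=> b _; rewrite setTI => ?; right; exists b.
Qed.

(** A class of cardinals is not a set, but below one of its members [k0] the
    members can be measured by the segments of [k0] into which they inject;
    a member that fits in the least such segment is minimal, and if no member
    fits in any segment then [k0] is. *)
Lemma least_cardinal (P : cardinal -> Prop) : (exists kappa, P kappa) ->
  exists2 kappa, P kappa & forall mu, P mu -> cardinal_le kappa mu.
Proof.
move=> [k0 Pk0].
pose S := [set b : k0 | exists2 mu : cardinal, P mu & [set: mu] #<= [set a | ord_lt a b]].
have [S0|/set0P/ord_min[b [mu Pmu mub] bmin]] := eqVneq S set0.
  exists k0 => // mu Pmu.
  have [//|[b mub]] := cardinal_le_or_segment k0 [set: mu].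
  by suff: S b; [rewrite S0|exists mu].
exists mu => // nu Pnu; apply: contrapT => nmn.
have [||] := @card_le_or_segment _ _ _ [set a | ord_lt a b] [set: nu] (@ord_lt_wf k0).
- by move=> x y _ _; exact: ord_lt_total.
- by move=> bn; apply: nmn; exact: card_le_trans bn.
- move=> [c cb nc]; have/ord_leNgt : ord_le b c.
    apply: bmin; exists nu => //; apply: card_le_trans nc _.
    by apply: subset_card_le => ? [].
  exact.
Qed.

(** * Cardinal arithmetic *)

Lemma closed_segment (kappa : cardinal) (b : kappa) :
  [set a | ord_le a b] `<=` [set a | ord_lt a b] `|` [set b].
Proof. by move=> a /= ab; have [->|] := pselect (a = b); [right|left]. Qed.

Lemma card_closed_segment (kappa mu : cardinal) (b : kappa) :
  infinite_cardinal mu -> [set a | ord_lt a b] #<= [set: mu] ->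
  [set a | ord_le a b] #<= [set: mu].
Proof.
move=> infmu bmu; have [fb|ib] := pselect (finite_set [set a | ord_lt a b]).
  apply: (@card_le_trans _ _ _ [set: nat]); last exact/infiniteP.
  apply: finite_set_countable; apply: sub_finite_set (@closed_segment _ b) _.
  by rewrite finite_setU; split=> //; exact: finite_set1.
apply: card_le_trans bmu; apply: card_le_trans (infinite_cardU1 b ib).
exact/subset_card_le/closed_segment.
Qed.

Lemma infinite_cardinal_segment (kappa : cardinal) (b : kappa) :
  infinite_cardinal kappa -> ~ ([set: kappa] #<= [set a | ord_le a b]).
Proof.
move=> ik kb; apply: (@ord_le_initial _ b).
apply: (card_le_trans kb).
apply: (card_le_trans (subset_card_le (@closed_segment _ b))).
apply: infinite_cardU1 => fb; apply: ik.
apply: card_le_finite kb _; apply: sub_finite_set (@closed_segment _ b) _.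
by rewrite finite_setU; split=> //; exact: finite_set1.
Qed.

Lemma wf_lex (T A : Type) (f : T -> A) (ltA : A -> A -> Prop) (ltT : T -> T -> Prop) :
  well_founded ltA -> well_founded ltT ->
  well_founded (fun p q => ltA (f p) (f q) \/ f p = f q /\ ltT p q).
Proof.
move=> wA wT; set lt2 := fun p q => _.
suff H a p : f p = a -> Acc lt2 p by move=> p; exact: H erefl.
elim: (wA a) p => {}a _ IHa p; elim: (wT p) => {}p _ IHp fp; constructor => q.
case=> [|[e qp]]; first by rewrite fp => qa; exact: (IHa _ qa).
by apply: (IHp _ qp); rewrite e.
Qed.

(** Order [D `*` D] by the larger coordinate first.  The predecessors of a pair
    with larger coordinate [m] lie in the square of the closed segment of [m],
    which is finite or, by hypothesis, no larger than that segment, hence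
    smaller than [D]; so [card_le_or_segment] can only give an injection. *)
Lemma card_square_initial (kappa : cardinal) (D : set kappa) :
  (forall c, D c -> ~ (D #<= [set a | ord_lt a c])) ->
  (forall c, D c -> infinite_set [set a | ord_lt a c] ->
    [set a | ord_lt a c] `*` [set a | ord_lt a c] #<= [set a | ord_lt a c]) ->
  infinite_set D -> D `*` D #<= D.
Proof.
move=> ini IH infD.
(* An arbitrary well-order R breaks the ties between pairs with the same larger
   coordinate, which makes lt2 below total. *)
have [R Rwo] := well_ordering_principle {classic kappa * kappa}.
have /choice[mx mxP] (p : kappa * kappa) : exists m : kappa,
    [/\ m = p.1 \/ m = p.2, ord_le p.1 m & ord_le p.2 m].
  have [xy|yx] := ord_le_total p.1 p.2.
    by exists p.2; split=> //; [right|exact: ord_lexx].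
  by exists p.1; split=> //; [left|exact: ord_lexx].
pose lt2 p q := ord_lt (mx p) (mx q) \/ mx p = mx q /\ (R p q /\ p <> q).
have lt2wf : well_founded lt2.
  by apply: wf_lex; [exact: ord_lt_wf|exact: well_order_wf Rwo].
have lt2tot p q : p <> q -> lt2 p q \/ lt2 q p.
  move=> pq; have [e|/ord_lt_total[?|?]] := pselect (mx p = mx q);
    [|by left; left|by right; left].
  have [?|?] := well_order_total Rwo p q; [left|right]; right; split=> //.
  by split=> // /esym.
have [|//|[p [Dp1 Dp2] Dp]] := card_le_or_segment (D := D `*` D) D lt2wf.
  by move=> p q _ _; exact: lt2tot.
pose m := mx p.
have Dm : D m by rewrite /m; case: (mxP p) => -[->|->].
pose seg := [set a | ord_lt a m]; pose cseg := [set a | ord_le a m].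
have Dcseg : D #<= cseg `*` cseg.
  apply: card_le_trans Dp _; apply: subset_card_le => q [_ /= qp].
  have qm : ord_le (mx q) m.
    by case: qp => [/ord_ltW//|[-> _]]; exact: ord_lexx.
  by case: (mxP q) => _ q1 q2; split; exact: ord_le_trans qm.
have [fseg|iseg] := pselect (finite_set seg).
  case: infD; apply: card_le_finite Dcseg _; apply: finite_setX;
  apply: sub_finite_set (@closed_segment _ m) _;
  by rewrite finite_setU; split=> //; exact: finite_set1.
case: (ini m Dm); apply: card_le_trans Dcseg _; apply: card_le_trans (IH m Dm iseg).
have csegs : cseg #<= seg.
  exact: card_le_trans (subset_card_le (@closed_segment _ m)) (infinite_cardU1 m iseg).
exact: card_leX.
Qed.

(** Hessenberg's theorem.  By induction every infinite segment absorbs its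
    square: either it is equipotent to a shorter segment, or it is initial and
    [card_square_initial] applies. *)
Lemma card_square (kappa : cardinal) : infinite_cardinal kappa ->
  [set: kappa * kappa] #<= [set: kappa].
Proof.
have segsq (b : kappa) : infinite_set [set a | ord_lt a b] ->
    [set a | ord_lt a b] `*` [set a | ord_lt a b] #<= [set a | ord_lt a b].
  elim: (ord_lt_wf b) => {}b _ IH binf.
  have [[c cb bc]|nseg] := pselect (exists2 c, ord_lt c b &
      [set a | ord_lt a b] #<= [set a | ord_lt a c]).
    have cinf : infinite_set [set a | ord_lt a c].
      by move=> fc; apply: binf; exact: card_le_finite bc fc.
    apply: card_le_trans (card_leX bc bc) (card_le_trans (IH c cb cinf) _).
    by apply: subset_card_le => a /= ac; exact: ord_lt_le_trans ac (ord_ltW cb).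
  apply: card_square_initial => // c cb bc.
  by apply: nseg; exists c.
move=> kinf; rewrite -setXTT.
by apply: card_square_initial => // c _; [exact: ord_le_initial|exact: segsq].
Qed.

(** A point of the union is encoded by the index of a set containing it and by
    its code in that set: an element of [kappa * kappa]. *)
Lemma card_bigcup_le (I T : Type) (kappa : cardinal) (B : set I) (F : I -> set T) :
  infinite_cardinal kappa -> B #<= [set: kappa] ->
  (forall i, B i -> F i #<= [set: kappa]) ->
  \bigcup_(i in B) F i #<= [set: kappa].
Proof.
move=> kinf Bk Fk.
have [->|/set0P[x0 [i0 Bi0 Fx0]]] := eqVneq (\bigcup_(i in B) F i) set0.
  exact: card_ge0.
apply: card_le_trans (card_square kinf).
have /card_le_injP[|e [_ einj]] := Bk; first by exists i0.
have [k0 _] := infinite_setN0 kinf.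
have /choice[idx idxP] x : exists i, (\bigcup_(i in B) F i) x -> B i /\ F i x.
  have [[i ? ?]|nx] := pselect ((\bigcup_(i in B) F i) x); first by exists i.
  by exists i0.
have /choice[h hinj] i : exists h : T -> kappa, B i -> set_inj (F i) h.
  have [[Bi [x Fx]]|nB] := pselect (B i /\ F i !=set0).
    have /card_le_injP[|h [_ ?]] := Fk i Bi; first by exists x.
    by exists h.
  exists (fun=> k0) => Bi x y; rewrite inE => Fx; case: nB; split=> //.
  by exists x.
apply/card_le_injP; first by exists x0, i0.
exists (fun x => (e (idx x), h (idx x) x)); split=> // x y.
rewrite !inE => /idxP[Bx Fx] /idxP[By Fy] [eidx].
have {}eidx : idx x = idx y by apply: einj => //; rewrite inE.
rewrite -eidx in Fy *; apply: hinj => //; by rewrite inE.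
Qed.

(** Here [D] is kappa^+, realised as an initial segment of [lambda], and the
    lemma is its regularity: an unbounded [B] of size at most [kappa] would
    exhibit [D] as a union of at most [kappa] segments of size at most [kappa],
    and then the first ordinal outside [D] would belong to [D]. *)
Lemma small_segments_regular (kappa lambda : cardinal) (B : set lambda) :
  let D := [set c : lambda | [set a | ord_lt a c] #<= [set: kappa]] in
  infinite_cardinal kappa -> ~ ([set: lambda] #<= [set: kappa]) ->
  B `<=` D -> B #<= [set: kappa] -> exists2 d, D d & forall b, B b -> ord_lt b d.
Proof.
move=> D kinf nlk BD Bk; apply: contrapT => nbd.
have DB : D `<=` \bigcup_(b in B) [set a | ord_le a b].
  move=> d Dd; apply: contrapT => nd; apply: nbd; exists d => // b Bb.
  apply: contrapT => /ord_leNgt db.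
  by apply: nd; exists b.
have Dk : D #<= [set: kappa].
  apply: (card_le_trans (subset_card_le DB)).
  apply: card_bigcup_le => // b /BD; exact: card_closed_segment.
have [D0|/set0P/ord_min[c nDc cmin]] := eqVneq (~` D) set0.
  by apply: nlk; rewrite -[setT]setC0 -D0 setCK.
apply: nDc.
apply: card_le_trans Dk; apply: subset_card_le => a ac.
by apply: contrapT => /cmin/ord_leNgt.
Qed.

Lemma finite_set_bounded (lambda : cardinal) (B : set lambda) (b0 : lambda) :
  finite_set B -> exists b, forall a, B a -> ord_le a b.
Proof.
move=> /(@finite_seqP {classic lambda})[s ->]; elim: s => [|c s [b bP]].
  by exists b0.
have [cb|bc] := ord_le_total c b; [exists b|exists c] => a.
  by rewrite /= inE => /orP[/eqP->|/bP].
rewrite /= inE => /orP[/eqP->|/bP ab]; first exact: ord_lexx.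
exact: ord_le_trans ab bc.
Qed.

(** [kappa] is the least cardinal of an unbounded subset of [lambda].  The last
    clause is this minimality: every set smaller than [kappa] is bounded. *)
Lemma cofinality (lambda : cardinal) : infinite_cardinal lambda ->
  exists kappa : cardinal, [/\ infinite_cardinal kappa,
    exists e : kappa -> lambda, forall b, exists i, ord_lt b (e i) &
    forall B : set lambda, ~ ([set: kappa] #<= B) ->
      exists b, forall a, B a -> ord_lt a b].
Proof.
move=> linf.
pose unbounded (B : set lambda) := forall b, exists2 a, B a & ord_lt b a.
have nomax (b : lambda) : exists c, ord_lt b c.
  apply: contrapT => /forallNP nb; apply: (@infinite_cardinal_segment _ b linf).
  by apply: subset_card_le => c _; apply/ord_leNgt/nb.
have bddVunb (B : set lambda) : ~ unbounded B -> exists b, forall a, B a -> ord_lt a b.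
  move=> nB; apply: contrapT => /forallNP nbd; apply: nB => b.
  have [c bc] := nomax b; have /existsNP[a /not_implyP[Ba /ord_leNgt ca]] := nbd c.
  by exists a => //; exact: ord_lt_le_trans bc ca.
have [|kappa [B Bunb Bk] kmin] := @least_cardinal
    (fun mu => exists2 B : set lambda, unbounded B & B #<= [set: mu]).
  exists lambda, setT; last exact: card_lexx.
  by move=> b; have [c] := nomax b; exists c.
have [b0 _] := infinite_setN0 linf.
exists kappa; split.
- move=> kfin; have [b bmax] := finite_set_bounded b0 (card_le_finite Bk kfin).
  by have [a /bmax/ord_leNgt] := Bunb b.
- have [a Ba _] := Bunb b0.
  have /card_le_injP[|g [_ ginj]] := Bk; first by exists a.
  have /choice[e eP] i : exists c, forall a, B a -> g a = i -> a = c.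
    have [[c [Bc <-]]|nc] := pselect (exists c, B c /\ g c = i).
      by exists c => d Bd; apply: ginj; rewrite inE.
    by exists b0 => c Bc gc; case: nc; exists c.
  exists e => b; have [c Bc bc] := Bunb b.
  by exists (g c); rewrite -(eP _ _ Bc erefl).
- move=> C nkC; apply: bddVunb => Cunb; apply: nkC.
  have [mu muC] := cardinal_of_set C; rewrite -(card_le_eqr muC).
  apply: kmin; exists C => //; rewrite (card_le_eqr muC); exact: card_lexx.
Qed.

(** * Convergent and free sequences *)

Lemma limit_in_closed (X : topologicalType) (kappa : cardinal) (s : kappa -> X)
    (x : X) (H : set X) :
  seq_converges s x -> closed H -> range s `<=` H -> H x.
Proof.
move=> sx Hcl sH; apply: contrapT => nHx.
have [b] := sx _ (closed_openC Hcl) nHx.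
by move=> /(_ (s b))[|]; [exists b => //; exact: ord_lexx|apply: sH; exists b].
Qed.

(** A term [s a] with [a] below [b] belongs to the head at [b], whereas [s b]
    belongs to the tail at [b]. *)
Lemma free_sequence_inj (X : topologicalType) (kappa : cardinal)
    (s : kappa -> X) : free_sequence s -> injective s.
Proof.
move=> free i j sij; apply: contrapT => /ord_lt_total.
wlog ij : i j sij / ord_lt i j.
  by move=> W [] ij; [apply: (W i j)|apply: (W j i)] => //; left.
move=> _; have := free j; apply/eqP/set0P; exists (s i); split.
  by apply: subset_closure; exists i.
by apply: subset_closure; exists j; [exact: ord_lexx|exact/esym].
Qed.

(** A free sequence longer than [kappa] is cut down to length kappa^+, that is
    to the indices in [D].  Lindelofness then provides a point in the closures
    of all the tails, and the union of the closures of the heads is closed by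
    regularity of kappa^+; freeness makes these two facts contradictory. *)
Lemma bounds_free_of_detect (X : topologicalType) (kappa : cardinal) :
  lindelof_space X -> infinite_cardinal kappa ->
  sequences_upto_detect_closed X kappa -> bounds_free_sequences X kappa.
Proof.
move=> hL kinf det lambda s sfree; apply: (card_le_trans (card_image_le _ _)).
apply: contrapT => nlk.
pose D := [set c : lambda | [set a | ord_lt a c] #<= [set: kappa]].
have bdd B : B `<=` D -> B #<= [set: kappa] ->
    exists2 d, D d & forall b, B b -> ord_lt b d.
  exact: small_segments_regular.
have up d : D d -> exists2 d', D d' & ord_lt d d'.
  move=> Dd; have [_ ->//||d' Dd' h] := bdd [set d]; last by exists d' => //; exact: h.
  apply: (@card_le_trans _ _ _ [set: nat]); last exact/infiniteP.
  exact: countable1.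
have [d0 Dd0 _] : exists2 d, D d & forall b, set0 b -> ord_lt b d.
  by apply: bdd => //; exact: card_ge0.
(* Tails of the truncated sequence: a point of tl d is then in the closure of
   s @` D, hence in G below. *)
pose tl d := closure (s @` (D `&` [set a | ord_le d a])).
have [p ptl] : exists p, forall d, D d -> tl d p.
  apply: contrapT => /forallNP np.
  have [||E [EC Ecount EX]] := hL [set U | exists2 d, D d & U = ~` tl d].
  - by move=> U [d _ ->]; apply: closed_openC; exact: closed_closure.
  - apply/seteqP; split=> // x _; apply: contrapT => nx; apply: (np x) => d Dd.
    by apply: contrapT => nt; apply: nx; exists (~` tl d) => //; exists d.
  have /choice[f fP] U : exists d, E U -> D d /\ U = ~` tl d.
    have [/EC[d Dd ->]|nE] := pselect (E U); first by exists d.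
    by exists d0.
  have [_ [U /fP[? _] <-]//||d Dd dE] := bdd (f @` E).
    apply: (@card_le_trans _ _ _ [set: nat]); last exact/infiniteP.
    exact: card_le_trans (card_image_le _ _) Ecount.
  have [U EU] : (\bigcup_(U in E) U) (s d) by rewrite EX.
  have [Df ->] := fP _ EU; apply; apply: subset_closure; exists d => //.
  by split=> //; apply/ord_ltW/dE; exists U.
pose G := \bigcup_(d in D) closure (head_set s d).
(* A sequence of length at most kappa in G lies in the closure of one head. *)
have Gcl : closed G.
  apply: contrapT => /det[mu [t [x [muinf muk tG nGx tx]]]].
  have /choice[f fP] i : exists d, D d /\ closure (head_set s d) (t i).
    by have [|d] := tG (t i); [exists i|exists d].
  have [_ [i _ <-]||d Dd dt] := bdd (range f); first by have [] := fP i.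
    exact: card_le_trans (card_image_le _ _) muk.
  apply: nGx; exists d => //; apply: limit_in_closed tx (@closed_closure _ _) _.
  move=> _ [i _ <-]; have [_] := fP i; apply: closureS => _ [a ai <-].
  by exists a => //; apply: ord_lt_le_trans ai _; apply/ord_ltW/dt; exists i.
have sG : s @` D `<=` G.
  move=> _ [a Da <-]; have [d Dd ad] := up a Da.
  by exists d => //; apply: subset_closure; exists a.
have [d Dd hd] : G p.
  rewrite (closure_id G).1//; apply: closureS sG _ _.
  by apply: closureS (ptl _ Dd0); apply: image_subset => ? [].
have : (closure (head_set s d) `&` closure (tail_set s d)) p.
  by split=> //; apply: closureS (ptl _ Dd); apply: image_subset => ? [].
by rewrite sfree.
Qed.

(** Each point of the closed set [closure (head_set s b)] is separated from [x],
    hence from a tail of [s].  Countably many of the separating open sets cover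
    this closed set, and an index above all the corresponding ones works for
    every point at once. *)
Lemma separate_head_tail (X : topologicalType) (lambda : cardinal)
    (s : lambda -> X) (x : X) (b : lambda) :
  lindelof_space X -> hausdorff_space X -> seq_converges s x ->
  (forall B : set lambda, countable B -> exists c, forall a, B a -> ord_lt a c) ->
  ~ closure (head_set s b) x ->
  exists c, closure (head_set s b) `&` closure (tail_set s c) = set0.
Proof.
move=> hL hH sx bdd nbx; set H := closure (head_set s b).
have sep y : H y -> exists U, [/\ open U, U y & exists c, U `&` closure (tail_set s c) = set0].
  move=> Hy; have yx : y != x by apply/eqP => e; rewrite e in Hy.
  move: hH; rewrite open_hausdorff => /(_ y x yx)[[U V] /= [/set_mem Uy /set_mem Vx]].
  move=> [Uop Vop /eqP UV]; have [c cV] := sx V Vop Vx.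
  exists U; split=> //; exists c; apply/seteqP; split=> // z [Uz].
  move=> /(_ U (open_nbhs_nbhs (conj Uop Uz)))[w [/cV Vw Uw]].
  by suff: (U `&` V) w by rewrite UV.
have [||E [EC Ecount EX]] := hL [set U | open U /\
    (U `<=` ~` H \/ exists c, U `&` closure (tail_set s c) = set0)].
- by move=> U [].
- apply/seteqP; split=> // y _; have [/sep[U [Uop Uy Uc]]|nHy] := pselect (H y).
    by exists U => //; split=> //; right.
  exists (~` H) => //; split; last by left.
  by apply: closed_openC; exact: closed_closure.
have /choice[f fP] U : exists c, E U -> ~ (U `<=` ~` H) -> U `&` closure (tail_set s c) = set0.
  have [[_ [c]]|nU] := pselect (E U /\ exists c, U `&` closure (tail_set s c) = set0).
    by exists c.
  exists b => EU nUH; case: nU; split=> //.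
  by have [_ []] := EC _ EU.
have [|c cP] := bdd (f @` E); first exact: sub_countable (card_image_le _ _) Ecount.
exists c; apply/seteqP; split=> // y [Hy cy].
have [U EU Uy] : (\bigcup_(U in E) U) y by rewrite EX.
have : (U `&` closure (tail_set s (f U))) y.
  split=> //; apply: closureS cy; apply: image_subset => a /= ca.
  by apply: ord_le_trans ca; apply/ord_ltW/cP; exists U.
by rewrite fP// => /(_ y Uy).
Qed.

(** The subsequence is extracted along the cofinality [mu] of the length.  The
    recursion keeps it increasing and cofinal, so that it still converges; when
    [mu] is uncountable it also keeps it free, and this bounds [mu]. *)
Lemma detect_of_bounds_free (X : topologicalType) (kappa : cardinal) :
  lindelof_space X -> hausdorff_space X -> almost_radial X ->
  infinite_cardinal kappa -> bounds_free_sequences X kappa ->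
  sequences_upto_detect_closed X kappa.
Proof.
move=> hL hH hR kinf bfree A /hR[x [[_ nAx] [lambda [s [linf sA sx hx]]]]].
have [mu [muinf [e ecof] bdd]] := cofinality linf.
have [b0 _] := infinite_setN0 linf.
pose separated (B : set lambda) (c : lambda) :=
  closure (s @` B) `&` closure (tail_set s c) = set0.
have [|u uP] := @wf_choice mu lambda (@ord_lt mu)
   (fun i B c => [/\ ord_lt (e i) c, forall a, B a -> ord_lt a c &
      ~ countable [set: mu] -> separated B c]) (@ord_lt_wf mu) b0.
  move=> i g; set B := g @` _.
  have [b bB] : exists b, forall a, B a -> ord_lt a b.
    apply: bdd => muB; apply: (@ord_le_initial _ i).
    exact: card_le_trans muB (card_image_le _ _).
  have [c1 c1P] : exists c, ~ countable [set: mu] -> separated B c.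
    have [|nc] := pselect (countable [set: mu]); first by exists b0.
    have [|c cP] := @separate_head_tail X lambda s x b hL hH sx _ (hx b).
      move=> C Ccount; apply: bdd => muC; apply: nc; exact: sub_countable muC Ccount.
    exists c => _; apply/seteqP; split=> // y [By cy].
    rewrite -cP; split=> //; apply: closureS By; apply: image_subset; exact: bB.
  (* Above e i for cofinality, above b to be increasing, above c1 to be free. *)
  have [c cP] : exists c, forall a, [set e i; b; c1] a -> ord_lt a c.
    apply: bdd => mu3; apply: muinf; apply: card_le_finite mu3 _; exact: finite_set3.
  exists c; split; first by apply: cP; left; left.
    by move=> a /bB ab; apply: ord_lt_le_trans ab _; apply/ord_ltW/cP; left; right.
  move=> /c1P BC; apply/seteqP; split=> // y [By cy]; rewrite -BC; split=> //.
  apply: closureS cy; apply: image_subset => a /= ca.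
  by apply: ord_le_trans ca; apply/ord_ltW/cP; right.
have umono i j : ord_le i j -> ord_le (u i) (u j).
  move=> ij; have [->|ne] := pselect (i = j); first exact: ord_lexx.
  by have [_ + _] := uP j; move=> h; apply/ord_ltW/h; exists i.
exists mu, (s \o u), x; split=> //.
- have [muc|nmuc] := pselect (countable [set: mu]).
    by apply: card_le_trans muc _; exact/infiniteP.
  have free : free_sequence (s \o u).
    move=> i; have [_ _ /(_ nmuc) sepi] := uP i.
    apply/seteqP; split=> // y [hy ty]; rewrite -sepi; split.
      by apply: closureS hy; rewrite image_comp.
    apply: closureS ty => _ [j ij <-]; exists (u j) => //; exact: umono.
  apply: card_le_trans (bfree _ _ free).
  rewrite (card_le_eqr (inj_card_eq _)); first exact: card_lexx.
  by apply: in2W; exact: free_sequence_inj free.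
- by move=> _ [i _ <-]; apply: sA; exists (u i).
- move=> U Uop Ux; have [b bU] := sx U Uop Ux; have [i bi] := ecof b.
  exists i => _ [j ij <-]; apply: bU; exists (u j) => //=.
  apply: ord_le_trans (ord_ltW bi) _; apply: ord_le_trans (umono _ _ ij).
  by have [/ord_ltW] := uP i.
Qed.

Theorem corollary4 (X : topologicalType) (hL : lindelof_space X)
    (hH : hausdorff_space X) (hR : almost_radial X) :
  exists kappa : cardinal,
    radial_character X kappa /\ free_sequence_number X kappa.
Proof.
have [|kappa [kinf kfree] kmin] := @least_cardinal
    (fun mu => infinite_cardinal mu /\ bounds_free_sequences X mu).
  (* X accounts for the range of every sequence, nat makes kappa infinite. *)
  have [kappa kX] := cardinal_of_set [set: X + nat].
  have Xk (T : Type) (f : T -> X + nat) : injective f -> [set: T] #<= [set: kappa].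
    move=> finj; rewrite (card_le_eqr kX) -(card_le_eql (@inj_card_eq _ _ _ f _)).
      exact: card_leT.
    by move=> ? ? _ _ /finj.
  exists kappa; split.
    by apply/infiniteP; apply: (Xk _ inr) => ? ? [].
  move=> lambda s _; apply: card_le_trans (card_leT _) _.
  by apply: (Xk _ inl) => ? ? [].
exists kappa; split; split=> //.
- exact: detect_of_bounds_free.
- by move=> mu muinf mudet; apply: kmin; split=> //; exact: bounds_free_of_detect.
- by move=> mu muinf mufree; exact: kmin.
Qed.
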